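(* Let $\kappa_0\in\mathbb C$. On the boundary component $\mathcal B^0_\infty$, the restricted Hamiltonian vector field of the fifth Painlevé equation is, in the coordinates $(R,P^0)$ and $(r,P^1)$ respectively, $$X^V_{\mathcal B^0_\infty}(R,P^0)=-R(2P^0+R-\kappa_0)\,\partial_R-P^0(P^0-\kappa_0)\,\partial_{P^0},$$ $$X^V_{\mathcal B^0_\infty}(r,P^1)=-r(2P^1-\kappa_0r+1)\,\partial_r-P^1(P^1+1)\,\partial_{P^1}.$$ The residual spectral data at the node, $$2P^0-\kappa_0-1+\frac{2P^0(P^0-\kappa_0)}{R}\qquad\text{and}\qquad-2P^1\kappa_0-\kappa_0-1+\frac{2P^1(P^1+1)}{r},$$ are first integrals of the respective vector fields, i.e. they are annihilated by them.
   Context: Put $\rho=\frac{(\kappa_0+\kappa_1-1)^2-\kappa_\infty^2}{4}$ for $\kappa_0,\kappa_1,\kappa_\infty\in\mathbb C$. The Hamiltonian vector field of the fifth Painlevé equation is $X^V=\partial_t+\frac{\partial H^V}{\partial p}\partial_q-\frac{\partial H^V}{\partial q}\partial_p$ with $$H^V=\frac{q(q-1)^2p^2-\big(\kappa_0(q-1)^2+(\kappa_1-1)q(q-1)-tq\big)p+\rho(q-1)}{t}.$$ Coordinates: $T=\frac1t$, $R=\frac qT=qt=\frac1r$, $P^0=pq$, $P^1=\frac{p(q-1)^2}{t}$. The component $\mathcal B^0_\infty$ lies over the exceptional curve of the blow-up at $(t,q)=(\infty,0)$; it is $\{T=0\}$ in the coordinates $(T,R,P^0)$ and $\{q=0\}$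 in the coordinates $(r,q,P^1)$. The restricted vector field is the limit of $X^V$, rescaled by a function, written in these coordinates: the limit as $T\to0$ of $-q\,t\,X^V$ in coordinates $(T,R,P^0)$, and the limit as $q\to0$ of $X^V$ in coordinates $(r,q,P^1)$. The two displayed functions are the residual spectral data at the node of the limit connection, which lives on a nodal curve. *)

(* Defs.v *)
From HB Require Import structures.
From mathcomp Require Import all_boot all_order all_algebra.
From mathcomp Require Import complex ring.
From mathcomp Require Import all_classical all_reals all_analysis.

Set Implicit Arguments.
Unset Strict Implicit.
Unset Printing Implicit Defensive.

Import Order.TTheory GRing.Theory Num.Theory.
Import numFieldNormedType.Exports.

Local Open Scope classical_set_scope.
Local Open Scope ring_scope.

(* Everything is stated over a numFieldType K, to be instantiated with the
   complex numbers R[i] over a realType R; limits and derivatives are then the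
   complex ones. *)

Section vector_fields.
Variables (K : numFieldType) (V W : normedModType K).

(* The derivation f |-> X f attached to a vector field X. *)
Definition act (X : V -> V) (f : V -> W) (x : V) : W := 'D_(X x) f x.

(* The vector field X written in the coordinates phi, whose inverse is psi. *)
Definition in_coords (phi : V -> W) (psi : W -> V) (X : V -> V) (y : W) : W :=
  act X phi (psi y).

Definition first_integral_on (D : set V) (X : V -> V) (f : V -> W) : Prop :=
  forall x, D x -> differentiable f x /\ act X f x = 0.

End vector_fields.

Section painleve5.
Variable K : numFieldType.
Variables k0 k1 koo : K.

Definition rho : K := ((k0 + k1 - 1) ^+ 2 - koo ^+ 2) / 4.

Definition HV (t q p : K) : K :=
  (q * (q - 1) ^+ 2 * p ^+ 2
   - (k0 * (q - 1) ^+ 2 + (k1 - 1) * q * (q - 1) - t * q) * p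
   + rho * (q - 1)) / t.

(* A vector field is given by its components along d/dt, d/dq, d/dp. *)
Definition XV (x : K * K * K) : K * K * K :=
  let: (t, q, p) := x in
  (1, derive1 (HV t q) p, - derive1 (fun q' => HV t q' p) q).

(* The rescaled field - q t X^V. *)
Definition mqtXV (x : K * K * K) : K * K * K :=
  let: (t, q, _) := x in (- q * t) *: XV x.

End painleve5.

Section coordinates.
Variable K : numFieldType.

(* The coordinates (T, R, P^0) as functions of (t, q, p), and conversely. *)
Definition chart0 (x : K * K * K) : K * K * K :=
  let: (t, q, p) := x in (1 / t, q * t, p * q).
Definition chart0_inv (y : K * K * K) : K * K * K :=
  let: (T, R, P) := y in (1 / T, R * T, P / (R * T)).
Definition chart0_dom : set (K * K * K) :=
  [set y | let: (T, R, _) := y in T != 0 /\ R != 0].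

(* The coordinates (r, q, P^1) as functions of (t, q, p), and conversely. *)
Definition chart1 (x : K * K * K) : K * K * K :=
  let: (t, q, p) := x in (1 / (q * t), q, p * (q - 1) ^+ 2 / t).
Definition chart1_inv (y : K * K * K) : K * K * K :=
  let: (r, q, P) := y in (1 / (q * r), q, P / (q * r * (q - 1) ^+ 2)).
Definition chart1_dom : set (K * K * K) :=
  [set y | let: (r, q, _) := y in [/\ r != 0, q != 0 & q != 1]].

Lemma chart0_invK y : chart0_dom y -> chart0 (chart0_inv y) = y.
Proof.
case: y => -[T R] P [T0 R0]; rewrite /chart0 /chart0_inv.
by congr (_, _, _); field; rewrite ?T0 ?R0.
Qed.

Lemma chart0K t q p : t != 0 -> q != 0 ->
  chart0_inv (chart0 (t, q, p)) = (t, q, p).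
Proof.
move=> t0 q0; rewrite /chart0 /chart0_inv.
by congr (_, _, _); field; rewrite ?t0 ?q0.
Qed.

Lemma chart1_invK y : chart1_dom y -> chart1 (chart1_inv y) = y.
Proof.
case: y => -[r q] P [r0 q0 q1]; rewrite /chart1 /chart1_inv.
have s0 : q - 1 != 0 by rewrite subr_eq0.
by congr (_, _, _); field; rewrite ?r0 ?q0 ?s0.
Qed.

Lemma chart1K t q p : t != 0 -> q != 0 -> q != 1 ->
  chart1_inv (chart1 (t, q, p)) = (t, q, p).
Proof.
move=> t0 q0 q1; rewrite /chart1 /chart1_inv.
have s0 : q - 1 != 0 by rewrite subr_eq0.
by congr (_, _, _); field; rewrite ?t0 ?q0 ?s0.
Qed.

(* The boundary component {T = 0}, resp. {q = 0}, parametrised by (R, P^0),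
   resp. (r, P^1).  These maps are linear, so they also describe the inclusion
   of the tangent spaces of the component. *)
Definition incl0 (u : K * K) : K * K * K := (0, u.1, u.2).
Definition incl1 (u : K * K) : K * K * K := (u.1, 0, u.2).

(* Y is the limit of X at every point of the component; the limit vector is in
   particular tangent to the component.  The limit is taken jointly in the three
   coordinates, over the points where chart_inv is a genuine inverse: for R = 0
   (resp. r = 0) there is no such point on the line with (R, P^0) (resp.
   (r, P^1)) fixed, and the field on the component is the continuous
   extension. *)
Definition restricts_to0 (X : K * K * K -> K * K * K) (Y : K * K -> K * K) :=
  forall u : K * K,
    in_coords chart0 chart0_inv X y
      @[y --> within chart0_dom (nbhs (incl0 u))] --> incl0 (Y u).

Definition restricts_to1 (X : K * K * K -> K * K * K) (Y : K * K -> K * K) :=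
  forall u : K * K,
    in_coords chart1 chart1_inv X y
      @[y --> within chart1_dom (nbhs (incl1 u))] --> incl1 (Y u).

End coordinates.

Section boundary.
Variable K : numFieldType.
Variable k0 : K.

Definition XB0 (u : K * K) : K * K :=
  let: (R, P) := u in (- R * (2 * P + R - k0), - P * (P - k0)).
Definition XB1 (u : K * K) : K * K :=
  let: (r, P) := u in (- r * (2 * P - k0 * r + 1), - P * (P + 1)).

(* The residual spectral data at the node of the limit connection, in each of
   the two coordinate systems; defined off {R = 0}, resp. {r = 0}. *)
Definition spectral0 (u : K * K) : K :=
  let: (R, P) := u in 2 * P - k0 - 1 + 2 * P * (P - k0) / R.
Definition spectral1 (u : K * K) : K :=
  let: (r, P) := u in - 2 * P * k0 - k0 - 1 + 2 * P * (P + 1) / r.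

End boundary.

(* Main.v *)
(** Off the boundary, each chart turns the (rescaled) field into a rational
    expression in the chart coordinates that is regular along the component:
    the poles in T, resp. in q, cancel.  The restricted field is then the value
    of that expression on the component, by continuity, and the first integrals
    are checked by differentiating. *)
Require Import Defs.
From HB Require Import structures.
From mathcomp Require Import all_boot all_order all_algebra.
From mathcomp Require Import complex ring.
From mathcomp Require Import all_classical all_reals all_analysis.

Set Implicit Arguments.
Unset Strict Implicit.
Unset Printing Implicit Defensive.

Import Order.TTheory GRing.Theory Num.Theory.
Import numFieldNormedType.Exports.

Local Open Scope classical_set_scope.
Local Open Scope ring_scope.

Section differentials.
Variables (K : numFieldType) (U V W : normedModType K).
Implicit Types (f g df dg : U -> K) (x v : U).

Lemma is_diff_derive (h dh : U -> V) x v : is_diff x h dh -> 'D_v h x = dh v.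
Proof. by move=> dhx; rewrite deriveE ?diff_val. Qed.

Lemma is_diff_fst_comp (h dh : U -> V * W) x :
  is_diff x h dh -> is_diff x (fun y => (h y).1) (fun v => (dh v).1).
Proof.
have cfst : continuous (fst : V * W -> V) by move=> z; exact: cvg_fst.
move=> dhx; apply: (@is_diff_comp _ _ _ _ h dh fst fst) => //.
by apply: DiffDef; [exact: linear_differentiable | rewrite diff_lin].
Qed.

Lemma is_diff_snd_comp (h dh : U -> V * W) x :
  is_diff x h dh -> is_diff x (fun y => (h y).2) (fun v => (dh v).2).
Proof.
have csnd : continuous (snd : V * W -> W) by move=> z; exact: cvg_snd.
move=> dhx; apply: (@is_diff_comp _ _ _ _ h dh snd snd) => //.
by apply: DiffDef; [exact: linear_differentiable | rewrite diff_lin].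
Qed.

(** From here on each differential has the form [fun v => ...], so that composing the rules yields
    an explicit expression in [v]. *)
Lemma is_diff_idfun x : is_diff x (fun y => y) (fun v => v).
Proof. exact: is_diff_id. Qed.

Lemma is_diff_const (a : K) x : is_diff x (fun _ => a) (fun _ => 0).
Proof. exact: is_diff_cst. Qed.

Lemma is_diff_add f g df dg x : is_diff x f df -> is_diff x g dg ->
  is_diff x (fun y => f y + g y) (fun v => df v + dg v).
Proof. exact: is_diffD. Qed.

Lemma is_diff_opp f df x : is_diff x f df ->
  is_diff x (fun y => - f y) (fun v => - df v).
Proof. exact: is_diffN. Qed.

Lemma is_diff_mul f g df dg x : is_diff x f df -> is_diff x g dg ->
  is_diff x (fun y => f y * g y) (fun v => f x * dg v + g x * df v).
Proof. exact: is_diffM. Qed.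

Lemma is_diff_sqr f df x : is_diff x f df ->
  is_diff x (fun y => f y ^+ 2) (fun v => f x * df v + f x * df v).
Proof. by move=> dfx; exact: is_diff_mul. Qed.

Lemma is_diff_inv f df x : is_diff x f df -> f x != 0 ->
  is_diff x (fun y => (f y)^-1) (fun v => - (f x) ^- 2 * df v).
Proof.
move=> dfx fx0; apply: DiffDef; first exact: differentiableV.
by rewrite diffV // diff_val.
Qed.

(** For [h] a field in a chart, meaningful on [D] only, and [k] an expression that extends it
    regularly to the boundary point [x]: continuity of [k] at [x] gives the limit. *)
Lemma differentiable_cvg_within (D : set U) (h k : U -> V) x l :
  (forall y, D y -> h y = k y) -> differentiable k x -> k x = l ->
  h y @[y --> within D (nbhs x)] --> l.
Proof.
move=> hk dk <-; apply: cvg_trans.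
  by apply: (fmap_within_eq (g := k)) => y; rewrite inE => /hk.
apply: cvg_within_filter.
by have := differentiable_continuous dk.
Qed.

End differentials.

(* Plain [apply] would let instance resolution close subgoals with point-free
   differentials such as [a *: id], on which [ring] and [field] fail. *)
Ltac auto_diff := repeat first
  [ notypeclasses refine (is_diff_const _ _)
  | notypeclasses refine (is_diff_idfun _)
  | notypeclasses refine (is_diff_pair _ _)
  | notypeclasses refine (is_diff_fst_comp _)
  | notypeclasses refine (is_diff_snd_comp _)
  | notypeclasses refine (is_diff_add _ _)
  | notypeclasses refine (is_diff_opp _)
  | notypeclasses refine (is_diff_sqr _)
  | notypeclasses refine (is_diff_mul _ _)
  | notypeclasses refine (is_diff_inv _ _) ].

Section hamiltonian.
Variable K : numFieldType.
Variables k0 k1 koo : K.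
Implicit Types (t q p : K).

Lemma derive1_HV_p t q p : derive1 (HV k0 k1 koo t q) p =
  (2 * q * (q - 1) ^+ 2 * p
   - (k0 * (q - 1) ^+ 2 + (k1 - 1) * q * (q - 1) - t * q)) / t.
Proof.
rewrite derive1E /HV; set f := (X in 'D_1 X p).
(* The differential is left open; [auto_diff] fills it in by unification while decomposing [f]. *)
evar (df : K -> K); have : is_diff p f df.
by rewrite /f /df; auto_diff.
by move=> /is_diff_derive ->; rewrite /df /=; ring.
Qed.

Lemma derive1_HV_q t q p : derive1 (fun q' => HV k0 k1 koo t q' p) q =
  (((q - 1) ^+ 2 + 2 * q * (q - 1)) * p ^+ 2
   - (2 * k0 * (q - 1) + (k1 - 1) * (2 * q - 1) - t) * p
   + rho k0 k1 koo) / t.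
Proof.
rewrite derive1E /HV; set f := (X in 'D_1 X q).
evar (df : K -> K); have : is_diff q f df.
by rewrite /f /df; auto_diff.
by move=> /is_diff_derive ->; rewrite /df /=; ring.
Qed.

End hamiltonian.

Section charts.
Variable K : numFieldType.
Variables k0 k1 koo : K.

Lemma derive_chart0 (t q p : K) (v : K * K * K) : t != 0 ->
  'D_v (@chart0 K) (t, q, p) =
  (- v.1.1 / t ^+ 2, q * v.1.1 + t * v.1.2, q * v.2 + p * v.1.2).
Proof.
move=> t0; set x := (t, q, p).
(* Projections replace the destructuring [let], which hides the arithmetic from [auto_diff]. *)
have -> : @chart0 K = fun x => (1 / x.1.1, x.1.2 * x.1.1, x.2 * x.1.2).
  by apply/funext => -[[]].
evar (d : K * K * K -> K * K * K); set f := (X in 'D_v X _).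
have : is_diff x f d by rewrite /f /d; auto_diff.
by move=> /is_diff_derive ->; rewrite /d /=; congr (_, _, _); field.
Qed.

Lemma derive_chart1 (t q p : K) (v : K * K * K) : t != 0 -> q != 0 ->
  'D_v (@chart1 K) (t, q, p) =
  (- (q * v.1.1 + t * v.1.2) / (q * t) ^+ 2, v.1.2,
   (q - 1) ^+ 2 / t * v.2 + 2 * p * (q - 1) / t * v.1.2
   - p * (q - 1) ^+ 2 / t ^+ 2 * v.1.1).
Proof.
move=> t0 q0; set x := (t, q, p).
have -> : @chart1 K =
    fun x => (1 / (x.1.2 * x.1.1), x.1.2, x.2 * (x.1.2 - 1) ^+ 2 / x.1.1).
  by apply/funext => -[[]].
evar (d : K * K * K -> K * K * K); set f := (X in 'D_v X _).
have : is_diff x f d by rewrite /f /d; auto_diff => //=; rewrite mulf_neq0.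
move=> /is_diff_derive ->; rewrite /d /=.
by congr (_, _, _); field; rewrite ?t0 ?q0.
Qed.

(* [- q t X^V] in the chart (T, R, P^0); it extends the field across {T = 0}. *)
Definition mqtXV_chart0 (y : K * K * K) : K * K * K :=
  let T := y.1.1 in let R := y.1.2 in let P := y.2 in
  let q := R * T in
  (R * T ^+ 2,
   - R * (q + 2 * P * (q - 1) ^+ 2 - k0 * (q - 1) ^+ 2
          - (k1 - 1) * q * (q - 1) + R),
   - (2 * (q - 1) ^+ 2 * P ^+ 2 - k0 * (q - 1) ^+ 2 * P
      - (k1 - 1) * q * (q - 1) * P
      - ((q - 1) ^+ 2 + 2 * q * (q - 1)) * P ^+ 2
      + q * (2 * k0 * (q - 1) + (k1 - 1) * (2 * q - 1)) * P
      - q ^+ 2 * rho k0 k1 koo)).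

(* [X^V] in the chart (r, q, P^1), with [1 / t = q r]; it extends the field across
   {q = 0}, and [Q] is [dq/dt / q]. *)
Definition XV_chart1 (y : K * K * K) : K * K * K :=
  let r := y.1.1 in let q := y.1.2 in let P := y.2 in
  let Q := 2 * P - r * (k0 * (q - 1) ^+ 2 + (k1 - 1) * q * (q - 1)) + 1 in
  (- r * (q * r + Q),
   q * Q,
   2 * P * q * Q / (q - 1) - P * q * r - P ^+ 2 * (1 + 2 * q / (q - 1))
   + q * r * P * (2 * k0 * (q - 1) + (k1 - 1) * (2 * q - 1)) - P
   - (q - 1) ^+ 2 * (q * r) ^+ 2 * rho k0 k1 koo).

(** The variable p enters only through q p = P and p / t = P / R, so no pole in T arises; the
    rescaling by - q t = - R clears the 1 / R. *)
Lemma in_coords_chart0 y : chart0_dom y ->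
  in_coords (@chart0 K) (@chart0_inv K) (mqtXV k0 k1 koo) y = mqtXV_chart0 y.
Proof.
case: y => -[T R] P [T0 R0].
rewrite /in_coords /act /chart0_inv /mqtXV /XV derive1_HV_p derive1_HV_q.
rewrite derive_chart0 ?mul1r ?invr_eq0 //= /GRing.scale /= /mqtXV_chart0 /=.
move: (rho k0 k1 koo) => c.
by congr (_, _, _); field; rewrite ?T0 ?R0.
Qed.

(** Here p enters only through p / t = P / (q - 1)^2, while 1 / t = q r. The denominators that
    remain are powers of q - 1, invertible near q = 0. *)
Lemma in_coords_chart1 y : chart1_dom y ->
  in_coords (@chart1 K) (@chart1_inv K) (XV k0 k1 koo) y = XV_chart1 y.
Proof.
case: y => -[r q] P [r0 q0 q1]; have s0 : q - 1 != 0 by rewrite subr_eq0.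
rewrite /in_coords /act /chart1_inv /XV derive1_HV_p derive1_HV_q.
rewrite derive_chart1 ?mul1r ?invr_eq0 ?mulf_neq0 //= /XV_chart1 /=.
move: (rho k0 k1 koo) => c.
by congr (_, _, _); field; rewrite ?r0 ?q0 ?s0.
Qed.

Lemma restricts_to0_mqtXV : restricts_to0 (mqtXV k0 k1 koo) (XB0 k0).
Proof.
case=> R P; apply: differentiable_cvg_within in_coords_chart0 _ _; last first.
  (* At T = 0 also q = R T = 0; the last component becomes - (2 P^2 - k0 P - P^2). *)
  by rewrite /mqtXV_chart0 /incl0 /=; congr (_, _, _); ring.
evar (d : K * K * K -> K * K * K); set f := mqtXV_chart0.
have df : is_diff (incl0 (R, P)) f d by rewrite /f /d; auto_diff.
exact: ex_diff.
Qed.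

Lemma restricts_to1_XV : restricts_to1 (XV k0 k1 koo) (XB1 k0).
Proof.
case=> r P; apply: differentiable_cvg_within in_coords_chart1 _ _; last first.
  (* At q = 0 the factor [Q] becomes 2 P - k0 r + 1. *)
  rewrite /XV_chart1 /incl1 /=.
  by congr (_, _, _); field.
evar (d : K * K * K -> K * K * K); set f := XV_chart1.
have df : is_diff (incl1 (r, P)) f d.
  (* The denominators q - 1 take the value -1 on the component. *)
  by rewrite /f /d; auto_diff; rewrite /= sub0r oppr_eq0 oner_eq0.
exact: ex_diff.
Qed.

End charts.

(** With A = P (P - k0), the R-derivative contributes 2 A (2 P + R - k0) / R and the P-derivative -
    A (2 + 2 (2 P - k0) / R); these cancel. *)
Lemma first_integral_spectral0 (K : numFieldType) (k0 : K) :
  first_integral_on [set u | u.1 != 0] (XB0 k0) (spectral0 k0).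
Proof.
case=> R P /= R0.
have -> : spectral0 k0 =
    fun u => 2 * u.2 - k0 - 1 + 2 * u.2 * (u.2 - k0) / u.1.
  by apply/funext => -[].
evar (d : K * K -> K); set f := (X in differentiable X _).
have df : is_diff (R, P) f d by rewrite /f /d; auto_diff.
split; first exact: ex_diff.
by rewrite /act (is_diff_derive _ df) /d /=; field.
Qed.

(** With B = P (P + 1), the contributions 2 B (2 P - k0 r + 1) / r and - B (2 (2 P + 1) / r - 2 k0)
    cancel. *)
Lemma first_integral_spectral1 (K : numFieldType) (k0 : K) :
  first_integral_on [set u | u.1 != 0] (XB1 k0) (spectral1 k0).
Proof.
case=> r P /= r0.
have -> : spectral1 k0 =
    fun u => - 2 * u.2 * k0 - k0 - 1 + 2 * u.2 * (u.2 + 1) / u.1.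
  by apply/funext => -[].
evar (d : K * K -> K); set f := (X in differentiable X _).
have df : is_diff (r, P) f d by rewrite /f /d; auto_diff.
split; first exact: ex_diff.
by rewrite /act (is_diff_derive _ df) /d /=; field.
Qed.

Theorem proposition2p4 (R : realType) (k0 k1 koo : R[i]) :
  [/\ restricts_to0 (mqtXV k0 k1 koo) (XB0 k0),
      restricts_to1 (XV k0 k1 koo) (XB1 k0),
      first_integral_on [set u | u.1 != 0] (XB0 k0) (spectral0 k0)
    & first_integral_on [set u | u.1 != 0] (XB1 k0) (spectral1 k0)].
Proof.
split.
- exact: restricts_to0_mqtXV.
- exact: restricts_to1_XV.
- exact: first_integral_spectral0.
- exact: first_integral_spectral1.
Qed.
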